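(* Let $n\ge 2$ and let $R$ be an $n$-skein relation, i.e. the skein relation of some $n$-crossing. Then its width satisfies $$w(R)\le \left\lfloor \frac{n^2}{2}\right\rfloor .$$
   Context: An $n$-crossing is a point of a link projection at which $n$ strands cross, each bisecting the crossing; locally it consists of $n$ distinct diameters of a disk, joining antipodal pairs among $2n$ equally spaced boundary points, at pairwise distinct heights. An $n$-split is a crossingless perfect matching of the $2n$ boundary points by $n$ disjoint arcs in the disk (up to isotopy). A-splits and B-splits: at a double crossing, the two regions swept out by rotating the overstrand counterclockwise until it meets the understrand are the A-regions; the A-split joins the two A-regions and has coefficient $A$; the B-split joins the other two regions and has coefficient $A^{-1}$. The $n$-skein relation of an $n$-crossing is the formal sum of $n$-splits with coefficients in $\mathbb Z[A^{\pm1}]$ defined recursively: a single strand ($n=1$) has the relation consisting of one arc with coefficient $A^0$. If $x'$ is an $(n+1)$-crossing, let $O$ be its top strand and $x$ the $n$-crossing obtained by deleting $O$. For each term in the $n$-skein relation of $x$, lay $O$ as an overstrand over its split (as a diameter meeting exactly the arcs whose endpoints it separates, each once), and resolve the resulting double crossings in all possible combinations of A-splits and B-splits, multiplying the coefficient by $A$ for each A-split and by $A^{-1}$ for each B-split. The sum of everything so obtained is the $(n+1)$-skein relation of $x'$. A term of the relation is a split together with a coefficient $JA^t$ ($J,t$ integers, $J\neq 0$); its power is $t$. The width $w(R)$ is the difference between the highest and the lowest power appearing in $R$. *)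

(* Defs.v *)
From HB Require Import structures.
From mathcomp Require Import all_boot all_order all_algebra.
From mathcomp Require Import finmap.
From mathcomp Require Import monalg.
From mathcomp Require Import zify.

Set Implicit Arguments.
Unset Strict Implicit.
Unset Printing Implicit Defensive.

Import Order.TTheory GRing.Theory Num.Theory.

Local Open Scope nat_scope.

(* The 2n boundary points of the disk are numbered counterclockwise by
   'I_(n.*2); the points i and i + n are antipodal. *)

Definition inside (a b z : nat) : bool := minn a b < z < maxn a b.

(* For distinct points of the circle: the chord ab separates c from d. *)
Definition separates (a b c d : nat) : bool := inside a b c (+) inside a b d.

(* A crossingless perfect matching is given by the map sending each boundary
   point to the other endpoint of its arc. *)
Definition is_split n (m : {ffun 'I_(n.*2) -> 'I_(n.*2)}) : bool :=
  [&& [forall i, m (m i) == i],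
      [forall i, m i != i] &
      [forall i : 'I_(n.*2), forall j : 'I_(n.*2),
         ~~ separates i (m i) j (m j)]].

Record nsplit n := NSplit {
  partner :> {ffun 'I_(n.*2) -> 'I_(n.*2)};
  nsplitP : is_split partner }.

HB.instance Definition _ n := [isSub for @partner n].
HB.instance Definition _ n := [Finite of nsplit n by <:].

(* Strand i is the diameter joining the points i and i + n; only the relative
   order of the heights matters. *)
Record crossing n := Crossing {
  height :> 'I_n -> nat;
  height_inj : injective height }.

Definition top_strand n (x : crossing n.+1) : 'I_n.+1 :=
  [arg max_(i > ord0) x i].

Definition delete_strand n (o : 'I_n.+1) (x : crossing n.+1) : crossing n :=
  Crossing (inj_comp (@height_inj _ x) (@lift_inj _ o)).

Lemma strand_start_subproof n (i : 'I_n) : i < n.*2.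
Proof. by have := ltn_ord i; lia. Qed.

Lemma strand_end_subproof n (i : 'I_n) : i + n < n.*2.
Proof. by have := ltn_ord i; lia. Qed.

Definition strand_start n (i : 'I_n) : 'I_(n.*2) :=
  Ordinal (strand_start_subproof i).

Definition strand_end n (i : 'I_n) : 'I_(n.*2) :=
  Ordinal (strand_end_subproof i).

Lemma embed_subproof n (o : 'I_n.+1) (j : 'I_(n.*2)) :
  bump (strand_end o) (bump (strand_start o) j) < n.+1.*2.
Proof. by have := ltn_ord j; rewrite /bump /=; lia. Qed.

(* The order preserving bijection from the boundary points left after the
   deletion of the strand o to the boundary points that are not on o. *)
Definition embed n (o : 'I_n.+1) (j : 'I_(n.*2)) : 'I_(n.+1.*2) :=
  Ordinal (embed_subproof o j).

(* The arcs of m met by the diameter o, each given by its endpoint to the right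
   of o oriented from strand_start o to strand_end o, in the order in which o
   meets them: as the arcs are disjoint, this is the counterclockwise order of
   these endpoints. *)
Definition crossed n (o : 'I_n.+1) (m : 'I_(n.*2) -> 'I_(n.*2)) :
    seq 'I_(n.*2) :=
  [seq j <- enum 'I_(n.*2) |
     inside (strand_start o) (strand_end o) (embed o j) &&
     separates (strand_start o) (strand_end o) (embed o j) (embed o (m j))].

(* Rotating the overstrand o counterclockwise, the A-regions of its double
   crossing with an arc are front left and back right.  Hence the A-split joins
   the part of o arriving at the crossing to the left half of the arc and the
   part of o leaving it to the right half, and the B-split the other way
   round.  With C the set of double crossings resolved by an A-split, the
   sequence below lists the endpoints of the arcs running along o: the arcs
   join its items 0 and 1, 2 and 3, etc. *)
Definition resolution_path n (o : 'I_n.+1) (m : 'I_(n.*2) -> 'I_(n.*2))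
    (C : {set 'I_(n.*2)}) : seq 'I_(n.+1.*2) :=
  strand_start o ::
    rcons (flatten [seq if j \in C then [:: embed o (m j); embed o j]
                        else [:: embed o j; embed o (m j)] | j <- crossed o m])
          (strand_end o).

Definition flip (i : nat) : nat := if odd i then i.-1 else i.+1.

Definition resolve_fun n (o : 'I_n.+1) (m : 'I_(n.*2) -> 'I_(n.*2))
    (C : {set 'I_(n.*2)}) (z : 'I_(n.+1.*2)) : 'I_(n.+1.*2) :=
  let w := resolution_path o m C in
  if z \in w then nth z w (flip (index z w))
  else if [pick j | embed o j == z] is Some j then embed o (m j) else z.

(* o and q are the endpoints of a diameter met by arcs r l, r' l', ... in this
   order. *)
Definition before (o q l l' : nat) :=
  [|| l' < l < o, (l < o) && (q < l') | q < l' < l].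

Lemma before_separates o q r l r' l' : o < r < r' -> r' < q ->
  ~~ (o <= l <= q) -> ~~ (o <= l' <= q) -> l != l' ->
  ~~ separates r l r' l' -> before o q l l'.
Proof. by rewrite /before /separates /inside; lia. Qed.

Definition not_after (o q r l X : nat) := X = o \/
  exists r0 l0, [/\ o < r0 < r, before o q l0 l & X \in [:: r0; l0]].

Lemma inside_next o q r l X : o < r < q -> ~~ (o <= l <= q) ->
  not_after o q r l X ->
  (inside X r l = inside X r q) * (inside X l r = inside X l q).
Proof.
rewrite /inside => h1 h2 [->|[r0 [l0 [h3]]]]; first by split; lia.
by rewrite /before !inE => /or3P[] h4 /orP[] /eqP ->; split; lia.
Qed.

Lemma inside_far o q r l r' l' X Y Z : o < r < r' -> r' < q ->
  ~~ (o <= l <= q) -> ~~ (o <= l' <= q) -> before o q l l' ->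
  not_after o q r l X -> Y \in [:: r; l] -> Z \in [:: r'; l'] ->
  inside X Y Z = inside X Y q.
Proof.
rewrite /before /inside !inE => h1 h2 h3 h4 h5.
case=> [->|[r0 [l0 [h6 h7]]]]; first last.
  rewrite !inE => /orP[] /eqP -> /orP[] /eqP -> /orP[] /eqP ->;
    move: h5 h7; case/or3P => ? /or3P[] ?; lia.
by move=> /orP[] /eqP -> /orP[] /eqP ->; move: h5 => /or3P[] ?; lia.
Qed.

Section ResolveSplit.

Lemma separatesC a b c d : separates a b c d = separates a b d c.
Proof. by rewrite /separates addbC. Qed.

Lemma separatesCl a b c d : separates a b c d = separates b a c d.
Proof. by rewrite /separates /inside minnC maxnC. Qed.

Lemma separates_sym a b c d : a != c -> a != d -> b != c -> b != d ->
  separates a b c d = separates c d a b.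
Proof.
rewrite /separates /inside !gtn_min !leq_max.
by case: (ltngtP a c); case: (ltngtP a d); case: (ltngtP b c);
  case: (ltngtP b d).
Qed.

Lemma flipK : involutive flip.
Proof.
by case=> [|i] //; rewrite /flip /=; case: (boolP (odd i)) => //= oi;
  case: i oi => //= i /negbTE ->.
Qed.

Variables (n : nat) (o : 'I_n.+1) (M : nsplit n) (C : {set 'I_(n.*2)}).

Let N := n.+1.
Let s := crossed o M.
Let w := resolution_path o M C.
Let e := embed o.
Let f j := if j \in C then e (M j) else e j.
Let g j := if j \in C then e j else e (M j).

Let SK (j : 'I_(n.*2)) : M (M j) = j.
Proof. by have /and3P[/forallP/(_ j)/eqP] := nsplitP M. Qed.

Let Sneq (j : 'I_(n.*2)) : M j != j.
Proof. by have /and3P[_ /forallP/(_ j)] := nsplitP M. Qed.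

Let Snsep (i j : 'I_(n.*2)) : ~~ separates i (M i) j (M j).
Proof. by have /and3P[_ _ /forallP/(_ i)/forallP/(_ j)] := nsplitP M. Qed.

Let on : o <= n. Proof. by have := ltn_ord o; lia. Qed.

Let eE j : e j = (if j < o then j : nat else if j < o + n then j.+1 else j.+2)
  :> nat.
Proof. by rewrite /e /embed /= /bump; case: ltnP; case: ltnP; lia. Qed.

Let e_inj : injective e.
Proof.
move=> i j eij; have : e i = e j :> nat by rewrite eij.
by rewrite !eE => h; apply/val_inj => /=; move: h; do !case: ifP; lia.
Qed.

Let e_sep i j k l : separates (e i) (e j) (e k) (e l) = separates i j k l.
Proof.
have H a b c : inside (e a) (e b) (e c) = inside a b c.
  have L x y : (e x < e y) = (x < y).
    by rewrite !eE; do !case: ifP; lia.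
  by rewrite /inside !gtn_min !leq_max !L.
by rewrite /separates !H.
Qed.

Let e_start j : e j != o :> nat.
Proof. by rewrite eE; do !case: ifP; lia. Qed.

Let e_end j : e j != o + N :> nat.
Proof. by rewrite eE /N; do !case: ifP; lia. Qed.

Let e_surj z : z != strand_start o -> z != strand_end o -> {j | e j = z}.
Proof.
rewrite -!(inj_eq val_inj) /= => h1 h2; have hz := ltn_ord z.
pose j := if z < o then z : nat else if z < o + N then z.-1 else z.-2.
move: h1 h2 hz; rewrite /N /= => h1 h2 hz.
have hj : j < n.*2 by rewrite /j /N; do !case: ifP; lia.
exists (Ordinal hj); apply/val_inj; rewrite [LHS]eE /= /j /N.
by case: (ltnP z o) => ?; case: (ltnP z (o + n.+1)) => ?; do ?case: ifP; lia.
Qed.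

Let right (z : nat) := o < z < o + N.

Let inside_right z : inside (strand_start o) (strand_end o) z = right z.
Proof. by rewrite /inside /right /= /N; lia. Qed.

Let s_mem j : (j \in s) = right (e j) && ~~ right (e (M j)).
Proof.
rewrite mem_filter mem_enum andbT /separates !inside_right -/e.
by case: (right _).
Qed.

Let s_uniq : uniq s.
Proof. exact/filter_uniq/enum_uniq. Qed.

Let s_ltn j0 i i' : i < i' -> i' < size s -> nth j0 s i < nth j0 s i'.
Proof.
move=> ii' i's.
have st : sorted ltn (map val s).
  rewrite /s /crossed.
  apply: (@subseq_sorted _ _ ltn_trans _ (map val (enum 'I_(n.*2)))).
    exact/map_subseq/filter_subseq.
  by rewrite val_enum_ord iota_ltn_sorted.
have i1 : i < size s by lia.
rewrite -!(nth_map j0 0 val) //.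
by apply: (sorted_ltn_nth ltn_trans) => //; rewrite inE size_map.
Qed.

Let wE : w = strand_start o ::
  rcons (flatten [seq [:: f j; g j] | j <- s]) (strand_end o).
Proof.
congr (_ :: rcons (flatten _) _).
by apply: eq_map => j; rewrite /f /g; case: ifP.
Qed.

Let flatE (l : seq 'I_(n.*2)) (h h' : 'I_(n.*2) -> 'I_(n.+1.*2)) z0 j0 i :
  i < size l ->
  (nth z0 (flatten [seq [:: h j; h' j] | j <- l]) i.*2 = h (nth j0 l i)) *
  (nth z0 (flatten [seq [:: h j; h' j] | j <- l]) i.*2.+1 = h' (nth j0 l i)).
Proof. by elim: l i => [|a l IH] [|i] //= /IH. Qed.

Let size_flat : size (flatten [seq [:: f j; g j] | j <- s]) = (size s).*2.
Proof. by elim: (s) => //= a l ->. Qed.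

Let size_w : size w = (size s).*2.+2.
Proof. by rewrite wE /= size_rcons size_flat. Qed.

Let fg_mem j z : (z \in [:: f j; g j]) = (z \in [:: e j; e (M j)]).
Proof. by rewrite /f /g; case: ifP; rewrite !inE // orbC. Qed.

Let flat_mem z : (z \in flatten [seq [:: f j; g j] | j <- s]) =
  [exists j in s, (z == e j) || (z == e (M j))].
Proof.
apply/flatten_mapP/exists_inP => -[j js].
  by rewrite fg_mem !inE => h; exists j.
by move=> h; exists j => //; rewrite fg_mem !inE.
Qed.

Let flat_uniq : uniq (flatten [seq [:: f j; g j] | j <- s]).
Proof.
have perm : perm_eq (flatten [seq [:: f j; g j] | j <- s])
                    (map e s ++ map (e \o M) s).
  elim: (s) => //= a l IH.
  rewrite /f /g; case: ifP => _; last first.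
    rewrite perm_cons perm_sym -cat1s perm_catCA /= perm_cons perm_sym.
    exact: IH.
  rewrite (perm_catCA [:: e (M a)] [:: e a]) /= perm_cons.
  rewrite perm_sym -[_ :: map _ l]cat1s perm_catCA /= perm_cons perm_sym.
  exact: IH.
have eS_inj : injective (e \o M).
  by move=> x y /e_inj /(congr1 M); rewrite !SK.
rewrite (perm_uniq perm) cat_uniq (map_inj_uniq e_inj) (map_inj_uniq eS_inj).
rewrite s_uniq andbT /=; apply/hasPn => z /mapP[j js ->] /=.
apply/mapP => -[i is_ ].
by move/e_inj => h; move: js is_; rewrite !s_mem -h => /andP[_ /negbTE ->].
Qed.

Let w_uniq : uniq w.
Proof.
rewrite wE /= rcons_uniq mem_rcons inE flat_uniq andbT negb_or !flat_mem.
apply/andP; split; [apply/andP; split|].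
- by rewrite -(inj_eq val_inj) /=; lia.
- apply/exists_inP => -[j _ /orP[] /eqP h].
    by move: (e_start j); rewrite -h eqxx.
  by move: (e_start (M j)); rewrite -h eqxx.
apply/exists_inP => -[j _ /orP[] /eqP h].
  by move: (e_end j); rewrite -h eqxx.
by move: (e_end (M j)); rewrite -h eqxx.
Qed.

Let w_memE z : (z \in w) =
  [|| z == strand_start o, z == strand_end o |
      [exists j in s, (z == e j) || (z == e (M j))]].
Proof. by rewrite wE inE mem_rcons inE flat_mem. Qed.

Let e_memw j : (e j \in w) = (j \in s) || (M j \in s).
Proof.
rewrite w_memE -!(inj_eq val_inj) /= (negbTE (e_start j)) (negbTE (e_end j)) /=.
apply/exists_inP/orP => [[i is_ /orP[] /eqP /e_inj ->]|[h|h]].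
- by left.
- by right; rewrite SK.
- by exists j => //; rewrite eqxx.
- by exists (M j) => //; rewrite SK eqxx orbT.
Qed.

Let r := resolve_fun o M C.

Let r_out j : e j \notin w -> r (e j) = e (M j).
Proof.
move=> h; rewrite /r /resolve_fun (negbTE h).
by case: pickP => [i /eqP /e_inj -> //|/(_ j)]; rewrite eqxx.
Qed.

Let out_e z : z \notin w -> exists2 j, z = e j & e (M j) \notin w.
Proof.
move=> h; have [z1 z2] : z != strand_start o /\ z != strand_end o.
  by move: h; rewrite w_memE !negb_or => /and3P[].
have [j jz] := e_surj z1 z2; exists j => //.
by move: h; rewrite -jz !e_memw SK orbC.
Qed.

Let flip_w i : i < size w -> flip i < size w.
Proof. by rewrite size_w /flip; case: ifP; lia. Qed.

Let r_in z0 i : i < size w -> r (nth z0 w i) = nth z0 w (flip i).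
Proof.
move=> iw; rewrite /r /resolve_fun mem_nth // index_uniq //.
by apply: set_nth_default; apply: flip_w.
Qed.

Let rK : involutive r.
Proof.
move=> z; have [/(nthP z)[i iw <-]|/[dup] zw /out_e[j zE jw]] := boolP (z \in w).
  by rewrite !r_in ?flip_w // flipK.
by rewrite zE r_out -?zE // r_out // SK zE.
Qed.

Let r_neq z : r z != z.
Proof.
have [/(nthP z)[i iw <-]|/[dup] zw /out_e[j zE jw]] := boolP (z \in w).
  by rewrite r_in // nth_uniq ?flip_w // /flip; case: ifP; lia.
by rewrite zE in zw *; rewrite r_out // (inj_eq e_inj) Sneq.
Qed.

Let inside_w j z : e j \notin w -> z \in w ->
  inside (e j) (e (M j)) z = inside (e j) (e (M j)) o.
Proof.
rewrite e_memw negb_or !s_mem SK => /andP[h1 h2].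
have [a1 a2] := (e_start j, e_end j).
have [b1 b2] := (e_start (M j), e_end (M j)).
have same : right (e j) = right (e (M j)).
  by move: h1 h2; case: (right (e j)); case: (right (e (M j))).
have other (y : nat) : y != o -> y != o + N -> right y != right (e j) ->
    inside (e j) (e (M j)) y = inside (e j) (e (M j)) o.
  by move: same a1 a2 b1 b2; rewrite /right /inside /N; lia.
rewrite w_memE => /or3P[/eqP -> //|/eqP ->|].
  by move: same a1 a2 b1 b2; rewrite /right /inside /N /=; lia.
case/exists_inP => i; rewrite s_mem => /andP[r1 r2].
have ns := Snsep j i; rewrite -e_sep /separates in ns.
have eqi : inside (e j) (e (M j)) (e i) = inside (e j) (e (M j)) (e (M i)).
  by move: ns; case: (inside _ _ _); case: (inside _ _ _).
have [hr|hr] := boolP (right (e j)).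
  have := other (e (M i)) (e_start _) (e_end _).
  by rewrite hr (negbTE r2) => /(_ isT) h /orP[] /eqP ->; rewrite ?eqi h.
have := other (e i) (e_start _) (e_end _).
by rewrite (negbTE hr) r1 => /(_ isT) h /orP[] /eqP ->; rewrite -?eqi h.
Qed.

Let s_geom j : j \in s ->
  (o < e j < o + N) * (~~ (o <= e (M j) <= o + N)).
Proof.
rewrite s_mem => /andP[h1 h2]; split => //.
by move: (e_start (M j)) (e_end (M j)) h2; rewrite /right; lia.
Qed.

Let s_before j0 i i' : i < i' -> i' < size s ->
  let j := nth j0 s i in let j' := nth j0 s i' in
  (o < e j < e j') * (before o (o + N) (e (M j)) (e (M j'))).
Proof.
move=> ii' i's j j'.
have jj' : j < j' by apply: s_ltn.
have [j1 j2] := s_geom (mem_nth j0 (ltn_trans ii' i's) : j \in s).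
have [j'1 j'2] := s_geom (mem_nth j0 i's : j' \in s).
have lt : e j < e j' by rewrite !eE; do !case: ifP; lia.
split; first by rewrite lt; case/andP: j1 => ->.
apply: (@before_separates _ _ (e j) _ (e j')) => //.
- by rewrite lt; case/andP: j1 => ->.
- by case/andP: j'1.
- rewrite (inj_eq (@ord_inj _)) (inj_eq e_inj); apply/eqP => /(congr1 M).
  by rewrite !SK => h; move: jj'; rewrite h ltnn.
by rewrite e_sep; exact: Snsep.
Qed.

Let w_even z0 j0 i : i < size s -> nth z0 w i.+1.*2 = g (nth j0 s i).
Proof.
move=> h; rewrite wE (doubleS i) /= nth_rcons size_flat.
by rewrite ifT; [have [_ ->] := flatE f g z0 j0 h|lia].
Qed.

Let w_odd z0 j0 i : i < size s -> nth z0 w i.*2.+1 = f (nth j0 s i).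
Proof.
move=> h; rewrite wE /= nth_rcons size_flat.
by rewrite ifT; [have [-> _] := flatE f g z0 j0 h|lia].
Qed.

Let w_last z0 : nth z0 w (size s).*2.+1 = strand_end o.
Proof. by rewrite wE /= nth_rcons size_flat ltnn eqxx. Qed.

Let inside_later z0 a t : a < size s -> a.+1.*2 <= t -> t < size w ->
  let X := nth z0 w a.*2 in let Y := nth z0 w a.*2.+1 in
  inside X Y (nth z0 w t) = inside X Y (o + N).
Proof.
move=> ak t1 t2 X Y.
have [j0 _] : {j0 : 'I_(n.*2) | true}.
  by case: (s) ak => // j *; exists j.
set j := nth j0 s a; have js : j \in s by apply: mem_nth.
have YE : Y = f j by rewrite /Y (w_odd _ j0).
have Ymem : (Y : nat) \in [:: e j : nat; e (M j) : nat].
  by rewrite YE /f; case: ifP; rewrite !inE eqxx ?orbT.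
have [r1 l1] := s_geom js.
have HX : not_after o (o + N) (e j) (e (M j)) X.
  rewrite /X; case: (a) ak @j {js YE Ymem r1 l1} => [|a'] ak.
    by left; rewrite wE.
  have [b1 b2] := s_before j0 (ltnSn a') ak.
  right; exists (e (nth j0 s a')), (e (M (nth j0 s a'))); split => //.
  rewrite (w_even _ j0) 1?ltnW // /g.
  by case: ifP; rewrite !inE eqxx ?orbT.
have fg i : (f i : nat) \in [:: e i : nat; e (M i) : nat]
  /\ (g i : nat) \in [:: e i : nat; e (M i) : nat].
  by rewrite /f /g; case: ifP; rewrite !inE !eqxx ?orbT.
have far i Z : a < i -> i < size s ->
    Z \in [:: e (nth j0 s i) : nat; e (M (nth j0 s i)) : nat] ->
    inside X Y Z = inside X Y (o + N).
  move=> ai ik HZ; have [b1 b2] := s_before j0 ai ik.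
  have [r2 l2] := s_geom (mem_nth j0 ik).
  by apply: (inside_far b1 _ l1 l2 b2 HX Ymem HZ); case/andP: r2.
move: t2; rewrite size_w => t2.
have := odd_double_half t; set b := t./2 => tE.
have b1 : a.+1 <= b by move: t1; rewrite -tE; case: (odd t); lia.
have b2 : b <= size s by move: t2; rewrite -tE; case: (odd t); lia.
rewrite -tE; case: (odd t); rewrite ?add0n ?add1n.
  have [bk|bk] := ltnP b (size s).
    by rewrite (w_odd _ j0) //; apply: (far b) => //; exact: (fg _).1.
  by have -> : b = size s by [lia]; rewrite w_last.
case: (b) b1 b2 => // b' b1 b2.
rewrite (w_even _ j0) //.
have [->|ab] := eqVneq b' a; last first.
  by apply: (far b') => //; [lia|exact: (fg _).2].
have [n1 n2] := inside_next r1 l1 HX.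
by rewrite -/j YE /f /g; case: ifP => _.
Qed.

Let nsep_path z0 a b : a < b -> b <= size s ->
  ~~ separates (nth z0 w a.*2) (nth z0 w a.*2.+1)
               (nth z0 w b.*2) (nth z0 w b.*2.+1).
Proof.
move=> ab bk; rewrite /separates.
by rewrite !inside_later ?addbb // ?size_w; lia.
Qed.

Let w_neq z0 i i' : i < size w -> i' < size w -> i != i' ->
  nth z0 w i != nth z0 w i' :> nat.
Proof. by move=> h1 h2 h3; rewrite (inj_eq (@ord_inj _)) nth_uniq. Qed.

Let r_path z0 i b c : i < size w -> let a := i./2.*2 in
  (separates (nth z0 w i) (r (nth z0 w i)) b c =
     separates (nth z0 w a) (nth z0 w a.+1) b c) *
  (separates b c (nth z0 w i) (r (nth z0 w i)) =
     separates b c (nth z0 w a) (nth z0 w a.+1)).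
Proof.
move=> iw a; rewrite r_in // /flip.
have := odd_double_half i; rewrite -/a; case: (odd i);
  rewrite ?add0n ?add1n => <-; split => //; first exact: separatesCl.
exact: separatesC.
Qed.

Let r_memw z : (r z \in w) = (z \in w).
Proof.
have H y : y \in w -> r y \in w.
  by case/(nthP y) => i iw <-; rewrite r_in // mem_nth // flip_w.
by apply/idP/idP => /H //; rewrite rK.
Qed.

Let r_nsep (z z' : 'I_(n.+1.*2)) : ~~ separates z (r z) z' (r z').
Proof.
have path_out y y' : y \in w -> y' \notin w -> ~~ separates y' (r y') y (r y).
  move=> yw /[dup] y'w /out_e[j y'E jw]; rewrite y'E in y'w *.
  by rewrite r_out // /separates !inside_w ?r_memw // addbb.
have neq y y' : y \in w -> y' \notin w -> y != y' :> nat.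
  by move=> yw; apply: contraNneq => /ord_inj <-.
have [zw|zw] := boolP (z \in w); have [zw'|zw'] := boolP (z' \in w).
- have /(nthP z)[i iw <-] := zw; have /(nthP z)[i' iw' <-] := zw'.
  have half l : l < size w -> l./2 <= size s by rewrite size_w; lia.
  rewrite (r_path z _ _ iw).1 (r_path z _ _ iw').2.
  move: (half _ iw) (half _ iw') => h h'.
  have [ii'|ii'|<-] := ltngtP i./2 i'./2; first exact: nsep_path.
    rewrite separates_sym ?nsep_path //; apply: w_neq; rewrite ?size_w; lia.
  by rewrite /separates /inside; lia.
- by rewrite separates_sym ?path_out // neq ?r_memw.
- exact: path_out.
have /out_e[j zE jw] := zw; have /out_e[j' zE' jw'] := zw'.
rewrite zE zE' in zw zw' *.
by rewrite !r_out // e_sep Snsep.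
Qed.

Lemma resolve_subproof : is_split (finfun r).
Proof.
apply/and3P; split; apply/forallP => z; first by rewrite !ffunE rK.
  by rewrite ffunE r_neq.
by apply/forallP => z'; rewrite !ffunE.
Qed.

End ResolveSplit.

Definition resolve n (o : 'I_n.+1) (M : nsplit n) (C : {set 'I_(n.*2)}) :
    nsplit n.+1 :=
  NSplit (resolve_subproof o M C).

Local Open Scope ring_scope.

(* Laurent polynomials in A with integer coefficients: << J *g t >> is J A^t.
   The multiplication provided by monalg requires exponents in a monoid without
   nontrivial units, hence mul_Apow. *)
Definition laurent := {malg int[int]}.

(* A^k c *)
Definition mul_Apow (k : int) (c : laurent) : laurent :=
  \sum_(t <- msupp c) << c@_t *g (k + t) >>.

Definition skein_relation n := {ffun nsplit n -> laurent}.

Lemma single_arc_subproof : is_split [ffun i : 'I_(1.*2) => rev_ord i].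
Proof.
apply/and3P; split; apply/forallP => i; first by rewrite !ffunE rev_ordK.
  by rewrite ffunE -(inj_eq (@ord_inj _)) /=; case: i => [[|[|?]]].
apply/forallP => j; rewrite !ffunE /=.
by case: i j => [[|[|?]] ?] [[|[|?]] ?].
Qed.

Definition single_arc : nsplit 1 := NSplit single_arc_subproof.

Definition strand_relation : skein_relation 1 :=
  [ffun M => if M == single_arc then << 1 *g 0 >> else 0].

Definition add_overstrand n (o : 'I_n.+1) (R : skein_relation n) :
    skein_relation n.+1 :=
  [ffun T => \sum_(M : nsplit n)
     let D := [set j in crossed o M] in
     \sum_(C in powerset D | resolve o M C == T)
        mul_Apow (#|C|%:Z - #|D :\: C|%:Z) (R M)].

(* There are no 0-crossings; the first branch is a dummy value. *)
Fixpoint skein n : crossing n -> skein_relation n :=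
  match n with
  | 0 => fun _ => [ffun=> 0]
  | n'.+1 =>
      match n' return (crossing n' -> skein_relation n') ->
                      crossing n'.+1 -> skein_relation n'.+1 with
      | 0 => fun _ _ => strand_relation
      | _.+1 => fun skein_n' x => let o := top_strand x in
          add_overstrand o (skein_n' (delete_strand o x))
      end (@skein n')
  end.

Definition is_skein_relation n (R : skein_relation n) : Prop :=
  exists x : crossing n, R = skein x.

Definition powers n (R : skein_relation n) : seq int :=
  flatten [seq (msupp (R M) : seq int) | M : nsplit n].

Definition highest_power n (R : skein_relation n) : int :=
  \big[Num.max/head 0 (powers R)]_(t <- powers R) t.

Definition lowest_power n (R : skein_relation n) : int :=
  \big[Num.min/head 0 (powers R)]_(t <- powers R) t.

Definition width n (R : skein_relation n) : int :=
  highest_power R - lowest_power R.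

(* Main.v *)
Require Import Defs.
From mathcomp Require Import all_boot all_order all_algebra.
From mathcomp Require Import finmap monalg.
From mathcomp Require Import zify.

(* Call gap line a diameter of the disk that avoids the 2n boundary points.
   For two terms of the relation, with splits M, M' and powers t, t', and for a
   gap line h, let z be the number of arcs of M and of M' met by h, counted
   together.  By induction on n,
     t - t' <= n^2 / 2,  and  t - t' <= z (2n - z) / 2  whenever z >= n;
   the second bound is decreasing in z.  Lay the new top strand O over M and M'
   along the gap line g, with zg crossings in all, and let a - a' <= zg be the
   change of t - t'.  A gap line h of the new disk comes from one of the old
   disk, say with z old and z1 new intersections.  Walking along O shows that
   either z1 <= z, and then the bound for g (if zg >= z1) or the one for h (if
   zg < z1) suffices, or z1 = z + 2, in which case all the crossings of O with
   arcs met by h are resolved in the same way, so that an arc count gives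
   a - a' + z <= 2n. *)

Set Implicit Arguments.
Unset Strict Implicit.
Unset Printing Implicit Defensive.

Import Order.TTheory GRing.Theory Num.Theory.

Local Open Scope nat_scope.

(** * Combinatorics of a walk along the overstrand *)

(* Fix a gap line and walk along the overstrand.  Each double crossing is a
   triple: whether the right end, resp. the left end, of the crossed arc is
   across the line from the starting point of the overstrand, and whether the
   crossing is resolved by an A-split.  [path_cut false] then counts the arcs
   along the overstrand that meet the line after the resolution. *)
Fixpoint path_cut (prev : bool) (l : seq (bool * bool * bool)) : nat :=
  if l is (r, l', c) :: s then
    (prev (+) (if c then l' else r)) + path_cut (if c then r else l') s
  else ~~ prev.

(** As the walk proceeds, the right ends change over to the far side of the gap line at most once,
    and so do the left ends. *)
Definition mono_step (p q : bool * bool * bool) : bool :=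
  (p.1.1 ==> q.1.1) && (p.1.2 ==> q.1.2).

Definition arc_cut (l : seq (bool * bool * bool)) :=
  count (fun p => p.1.1 (+) p.1.2) l.
Definition count_A (l : seq (bool * bool * bool)) := count (fun p => p.2) l.
Definition count_B (l : seq (bool * bool * bool)) := count (fun p => ~~ p.2) l.
(** The overstrand and the gap line cut the disk into four quadrants. [count_before] and
    [count_after] count the ends of crossed arcs in the two pairs of opposite quadrants. *)
Definition count_before (l : seq (bool * bool * bool)) :=
  count (fun p => ~~ p.1.1) l + count (fun p => p.1.2) l.
Definition count_after (l : seq (bool * bool * bool)) :=
  count (fun p => p.1.1) l + count (fun p => ~~ p.1.2) l.

(** Equality with [arc_cut l] cannot occur, by parity. The two inequalities bound the change of
    power from above and from below: the first will serve for [M], the second for [M']. *)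
Definition path_alternative (l : seq (bool * bool * bool)) : Prop :=
  path_cut false l < arc_cut l \/
  [/\ path_cut false l = (arc_cut l).+1,
      count_A l + arc_cut l <= count_B l + count_before l &
      count_B l + arc_cut l <= count_A l + count_after l].

Lemma path_cut_both l : all (fun p => p.1.1 && p.1.2) l ->
  [/\ path_cut true l = 0, path_cut false l = 1 & path_alternative l].
Proof.
rewrite /path_alternative /count_before /count_after => h.
have [h0 h1 h2] :
    [/\ path_cut true l = 0, path_cut false l = 1 & arc_cut l = 0].
  elim: l h => //= -[[[] []] []] l IH //= /IH [h1 h2 h3] //;
  by split; rewrite /arc_cut /= -/(arc_cut l); lia.
split=> //; right; rewrite h1 h2; split=> //.
  rewrite /count_A /count_B.
  by elim: l h {h0 h1 h2} => //= -[[[] []] []] l IH //= /IH; lia.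
rewrite /count_A /count_B.
by elim: l h {h0 h1 h2} => //= -[[[] []] []] l IH //= /IH; lia.
Qed.

(** Let the path be on the near side when it reaches a cut arc. A B-split there costs one
    intersection and keeps the path near; an A-split costs none and moves it to the far side, which
    saves an intersection for good. So growth forces a B-split at every cut arc. *)
Lemma path_cut_right l : all (fun p => p.1.1) l -> pairwise mono_step l ->
  path_cut true l <= arc_cut l /\ path_alternative l.
Proof.
elim: l => [|[[[] [] ] c] l IH] //.
- by move=> _ _; split=> //; right.
- move=> _; rewrite pairwise_cons => /andP[hm _].
  have h' : all (fun p => p.1.1 && p.1.2) ((true, true, c) :: l).
    rewrite /=; apply: sub_all hm => -[[r l'] c'] /=.
    by rewrite /mono_step /= => /andP[-> ->].
  by have [-> _ alt] := path_cut_both h'.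
move=> /= hr /andP[_ /(IH hr)] [h1 h2]; move: h2.
rewrite /path_alternative /arc_cut /count_A /count_B in h1 *.
rewrite /count_before /count_after /= in h1 *.
by case: c => /=; move=> [h2|[h2 h3 h4]]; split; try (by lia);
  solve [left; lia | right; split; lia].
Qed.

(** Reflection in the overstrand, which also exchanges the two kinds of splits. *)
Definition swap_sides (p : bool * bool * bool) := (p.1.2, p.1.1, ~~ p.2).

Lemma path_cut_swap b l : path_cut b (map swap_sides l) = path_cut b l.
Proof. by elim: l b => //= -[[r l'] []] l IH b /=; rewrite IH. Qed.

Lemma path_alternative_swap l :
  path_alternative (map swap_sides l) -> path_alternative l.
Proof.
rewrite /path_alternative path_cut_swap.
have -> : arc_cut (map swap_sides l) = arc_cut l.
  by rewrite /arc_cut count_map; apply: eq_count => p /=; rewrite addbC.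
have -> : count_A (map swap_sides l) = count_B l by rewrite /count_A count_map.
have -> : count_B (map swap_sides l) = count_A l.
  by rewrite /count_B count_map; apply: eq_count => p /=; rewrite negbK.
have -> : count_before (map swap_sides l) = count_after l.
  by rewrite /count_before !count_map addnC.
have -> : count_after (map swap_sides l) = count_before l.
  by rewrite /count_after !count_map addnC.
by move=> [?|[? ? ?]]; [left|right; split].
Qed.

Lemma path_alternativeP l : pairwise mono_step l -> path_alternative l.
Proof.
elim: l => [|[[r l'] c] l IH]; first by move=> _; right.
move=> /[dup] pw /=/andP[hm /IH alt].
case: r l' hm pw => -[] hm pw.
- apply: (path_cut_right _ pw).2 => /=; apply: sub_all hm => p.
  by rewrite /mono_step /= => /andP[].
- apply: (path_cut_right _ pw).2 => /=; apply: sub_all hm => p.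
  by rewrite /mono_step /= => /andP[].
- apply: path_alternative_swap; apply: (path_cut_right _ _).2.
    by rewrite all_map /=; apply: sub_all hm.
  rewrite pairwise_map; apply: sub_pairwise pw => p q.
  by rewrite /mono_step /= andbC.
(* If both ends of the first arc are near, either split leaves the path near without an
   intersection, and each pair of quadrants receives one end. *)
move: alt; rewrite /path_alternative /arc_cut /count_A /count_B.
rewrite /count_before /count_after.
by case: c {pw hm} => /=; move=> [h|[h1 h2 h3]];
  solve [left; lia | right; split; lia].
Qed.

(** * Sums over the ends of the arcs of a resolved split *)

Lemma partnerK n (M : nsplit n) : involutive M.
Proof. by move=> j; have /and3P[/forallP/(_ j)/eqP] := nsplitP M. Qed.

Lemma partner_nsep n (M : nsplit n) (i j : 'I_(n.*2)) :
  ~~ separates i (M i) j (M j).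
Proof. by have /and3P[_ _ /forallP/(_ i)/forallP/(_ j)] := nsplitP M. Qed.

Lemma val_embed n (o : 'I_n.+1) (j : 'I_(n.*2)) : embed o j =
  (if j < o then j : nat else if j < o + n then j.+1 else j.+2) :> nat.
Proof. by rewrite /= /bump; case: ltnP; case: ltnP; lia. Qed.

Lemma embed_inj n (o : 'I_n.+1) : injective (embed o).
Proof.
move=> i j eij; apply/val_inj => /=.
have : embed o i = embed o j :> nat by rewrite eij.
by rewrite !val_embed; do !case: ifP; lia.
Qed.

Lemma embed_neq n (o : 'I_n.+1) j :
  (embed o j != strand_start o) && (embed o j != strand_end o).
Proof.
rewrite -!(inj_eq (@ord_inj _)) val_embed /=.
by have := ltn_ord o; do !case: ifP; lia.
Qed.

Lemma strand_neq n (o : 'I_n.+1) : strand_start o != strand_end o.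
Proof. by rewrite -(inj_eq val_inj) /=; lia. Qed.

Lemma sum_embed n (o : 'I_n.+1) (F : 'I_(n.+1.*2) -> nat) :
  \sum_z F z = F (strand_start o) + F (strand_end o) + \sum_j F (embed o j).
Proof.
rewrite (bigD1_ord (strand_end o)) //=.
(* The larger label [strand_end o] is removed first, so [strand_start o] still has label [o] among
   the remaining points. *)
have ho : o < n.*2.+1 by have := ltn_ord o; lia.
rewrite (bigD1_ord (Ordinal ho)) //= addnA [F (strand_end o) + _]addnC.
congr (F _ + _ + _); first by apply/val_inj; rewrite /= /bump; lia.
by apply: eq_bigr => j _; congr F; apply/val_inj.
Qed.

Section Crossed.

Variables (n : nat) (o : 'I_n.+1) (M : nsplit n).

Definition right_of (j : 'I_(n.*2)) : bool := o <= j < o + n.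

Lemma inside_embed j :
  inside (strand_start o) (strand_end o) (embed o j) = right_of j.
Proof.
have := ltn_ord o; rewrite /inside /right_of val_embed /=.
by do !case: ifP; lia.
Qed.

Lemma crossedE :
  crossed o M = [seq j <- enum 'I_(n.*2) | right_of j && ~~ right_of (M j)].
Proof.
apply: eq_filter => j; rewrite /separates !inside_embed.
by case: right_of.
Qed.

Lemma crossed_uniq : uniq (crossed o M).
Proof. exact/filter_uniq/enum_uniq. Qed.

Lemma mem_crossed j : (j \in crossed o M) = right_of j && ~~ right_of (M j).
Proof. by rewrite crossedE mem_filter mem_enum andbT. Qed.

Definition crosses (j : 'I_(n.*2)) : bool := right_of j (+) right_of (M j).

Lemma sum_crosses (F : 'I_(n.*2) -> nat) :
  \sum_(j | crosses j) F j = \sum_(j <- crossed o M) (F j + F (M j)).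
Proof.
rewrite big_split /= !(big_uniq _ crossed_uniq) /=.
rewrite (bigID (mem (crossed o M))) /=; congr (_ + _).
  apply: eq_bigl => j; rewrite mem_crossed /crosses.
  by case: right_of; case: right_of.
rewrite (reindex_inj (inv_inj (partnerK M))).
apply: eq_bigl => j; rewrite !mem_crossed /crosses partnerK.
by case: right_of; case: right_of.
Qed.

Variable C : {set 'I_(n.*2)}.

Let e := embed o.
Let w := resolution_path o M C.

Definition path_pair j :=
  if j \in C then [:: e (M j); e j] else [:: e j; e (M j)].

Lemma resolution_pathE :
  w = strand_start o ::
        rcons (flatten [seq path_pair j | j <- crossed o M]) (strand_end o).
Proof. by []. Qed.

Lemma perm_path (l : seq 'I_(n.*2)) :
  perm_eq (flatten [seq path_pair j | j <- l]) (map e (l ++ map M l)).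
Proof.
elim: l => //= j l IH.
apply: (@perm_trans _ (path_pair j ++ map e (l ++ map M l))).
  by rewrite perm_cat2l.
rewrite !map_cat /=.
have hp : perm_eq (path_pair j) [:: e j; e (M j)].
  by rewrite /path_pair; case: ifP => // _; rewrite (perm_catC [:: _] [:: _]).
apply: (perm_trans (perm_cat hp (perm_refl _))).
by rewrite /= perm_cons -cat1s perm_catCA.
Qed.

Lemma path_uniq : uniq w.
Proof.
have notin (z : 'I_(n.+1.*2)) : (forall j, e j != z) ->
    z \notin flatten [seq path_pair j | j <- crossed o M].
  move=> hz; rewrite (perm_mem (perm_path _)); apply/mapP => -[j _ zE].
  by have := hz j; rewrite zE eqxx.
rewrite resolution_pathE /= rcons_uniq mem_rcons inE negb_or strand_neq.
rewrite !notin; try by [move=> j; case/andP: (embed_neq o j)].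
rewrite (perm_uniq (perm_path _)) (map_inj_uniq (@embed_inj _ o)) cat_uniq.
rewrite crossed_uniq (map_inj_uniq (inv_inj (partnerK M))) crossed_uniq /=.
rewrite andbT; apply/hasPn => _ /mapP[j js ->] /=.
by move: js; rewrite !mem_crossed partnerK => /andP[-> _]; rewrite andbF.
Qed.

Lemma mem_path j : (e j \in w) = crosses j.
Proof.
rewrite resolution_pathE inE mem_rcons inE.
have /andP[/negbTE -> /negbTE ->] := embed_neq o j.
rewrite (perm_mem (perm_path _)) (mem_map (@embed_inj _ o)) mem_cat.
rewrite -{2}(partnerK M j) (mem_map (inv_inj (partnerK M))) !mem_crossed.
by rewrite partnerK /crosses; case: right_of; case: right_of.
Qed.

Lemma resolve_path z : z \in w -> resolve o M C z = nth z w (flip (index z w)).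
Proof. by move=> zw; rewrite ffunE /resolve_fun zw. Qed.

Lemma resolve_embed j : ~~ crosses j -> resolve o M C (e j) = e (M j).
Proof.
rewrite -mem_path ffunE /resolve_fun => /negbTE ->.
by case: pickP => [i /eqP /embed_inj -> //|/(_ j)]; rewrite eqxx.
Qed.

Lemma sum_path (G : 'I_(n.+1.*2) -> nat) :
  \sum_(z <- w) G z =
  G (strand_start o) + G (strand_end o) + \sum_(j | crosses j) G (e j).
Proof.
rewrite resolution_pathE big_cons -cats1 big_cat big_seq1 /= big_flatten /=.
rewrite big_map sum_crosses addnAC addnA; congr (_ + _ + _).
apply: eq_bigr => j _; rewrite /path_pair.
by case: ifP => _; rewrite big_cons big_seq1 // addnC.
Qed.

Lemma sum_resolve (F : rel 'I_(n.+1.*2)) :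
  \sum_z F z (resolve o M C z) =
  \sum_(z <- w) F z (nth z w (flip (index z w))) +
  \sum_(j | ~~ crosses j) F (e j) (e (M j)).
Proof.
rewrite (sum_embed o) (bigID crosses) /= addnA.
rewrite -(sum_path (fun z => F z (resolve o M C z) : nat)); congr (_ + _).
  by apply: eq_big_seq => z /resolve_path ->.
by apply: eq_bigr => j /resolve_embed ->.
Qed.

End Crossed.

Lemma flipSS i : flip i.+2 = (flip i).+2.
Proof. by case: i => [|i] //; rewrite /flip /= negbK; case: odd. Qed.

Fixpoint pairs_sum (T : Type) (F : T -> T -> nat) (w : seq T) : nat :=
  if w is a :: b :: w' then F a b + F b a + pairs_sum F w' else 0.

(** [flip] exchanges the positions 2i and 2i+1, so the sum splits into consecutive pairs, each seen
    from both of its ends. *)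
Lemma sum_flip (T : eqType) (F : T -> T -> nat) (w : seq T) :
  uniq w -> ~~ odd (size w) ->
  \sum_(z <- w) F z (nth z w (flip (index z w))) = pairs_sum F w.
Proof.
have [k] := ubnP (size w); elim: k w => // k IH [|a [|b w]] //=.
  by rewrite big_nil.
rewrite negbK !ltnS inE negb_or => hk /and3P[/andP[ab aw] bw uw] hw.
rewrite !big_cons /= !eqxx (negbTE ab) /= addnA; congr (_ + _).
rewrite -IH //; last by lia.
apply: eq_big_seq => z zw.
have za : (a == z) = false by apply/negP => /eqP az; rewrite az zw in aw.
have zb : (b == z) = false by apply/negP => /eqP az; rewrite az zw in bw.
by rewrite za zb flipSS.
Qed.

(** * Gap lines and their intersections with a split *)

Definition side (n t z : nat) : bool := t <= z < t + n.

(* Every arc that meets the gap line t is counted twice, once for each end. *)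
Definition cut n (t : nat) (M : nsplit n) : nat :=
  \sum_(z < n.*2) (side n t z (+) side n t (M z)).

(** Deleting the strand [o] removes one of the points labelled below [t] exactly when [o < t], hence
    the shift of the gap line. *)
Lemma side_embed n (o : 'I_n.+1) t (j : 'I_(n.*2)) : t <= n.+1 ->
  side n.+1 t (embed o j) = side n (t - (o < t)) j.
Proof.
have := ltn_ord o; rewrite /side val_embed.
by case: (ltnP o t); do !case: ifP; lia.
Qed.

Lemma cut_crossed n (o : 'I_n.+1) (M : nsplit n) :
  cut o M = (size (crossed o M)).*2.
Proof.
rewrite /cut (bigID (crosses o M)) /= [X in _ + X]big1 ?addn0; last first.
  by move=> j; rewrite /crosses /right_of /side => /negbTE ->.
rewrite sum_crosses -[in RHS]muln2 -sum1_size big_distrl /=.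
apply: eq_big_seq => j; rewrite mem_crossed partnerK /right_of /side.
by case/andP=> -> /negbTE ->.
Qed.

(** * Change of a cut when an overstrand is laid and resolved *)

Section Walk.

Variables (n : nat) (o : 'I_n.+1) (t : nat).
Hypothesis ht : t <= n.+1.

(** Sides are taken relative to the start of the overstrand, so that the walk begins at [false] and
    ends at [true]. *)
Definition far (z : 'I_(n.+1.*2)) : bool :=
  side n.+1 t z (+) side n.+1 t (strand_start o).

Lemma far_start : far (strand_start o) = false.
Proof. by rewrite /far addbb. Qed.

Lemma far_end : far (strand_end o) = true.
Proof. by have := ltn_ord o; move: ht; rewrite /far /side /=; lia. Qed.

(* For j to the right of o: j comes before the gap line; for j to the left of o:
   j comes after it. *)
Definition before_far (j : 'I_(n.*2)) : bool :=
  right_of o j (+) far (embed o j).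

Variables (M : nsplit n) (C : {set 'I_(n.*2)}).

Definition walk :=
  [seq (far (embed o j), far (embed o (M j)), j \in C) | j <- crossed o M].

Definition uncrossed_cut :=
  \sum_(j | ~~ crosses o M j) (far (embed o j) (+) far (embed o (M j))).

Lemma cut_walk :
  cut (t - (o < t)) M = (arc_cut walk).*2 + uncrossed_cut.
Proof.
have farE (i j : 'I_(n.*2)) :
    side n (t - (o < t)) i (+) side n (t - (o < t)) j =
    far (embed o i) (+) far (embed o j).
  by rewrite /far !side_embed // addbACA addbb addbF.
rewrite /cut (eq_bigr _ (fun j _ => congr1 nat_of_bool (farE j (M j)))).
rewrite (bigID (crosses o M)) /= sum_crosses; congr (_ + _).
rewrite /arc_cut count_map -sum1_count [in RHS]big_mkcond /=.
rewrite -[in RHS]muln2 big_distrl /=.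
by apply: eq_bigr => j _; rewrite partnerK; case: far; case: far.
Qed.

Lemma cut_resolve :
  cut t (resolve o M C) = (path_cut false walk).*2 + uncrossed_cut.
Proof.
have farE (z z' : 'I_(n.+1.*2)) :
    side n.+1 t z (+) side n.+1 t z' = far z (+) far z'.
  by rewrite /far addbACA addbb addbF.
rewrite /cut (eq_bigr _ (fun z _ => congr1 nat_of_bool (farE z _))).
rewrite (sum_resolve _ _ _ (fun z z' => far z (+) far z')); congr (_ + _).
rewrite (sum_flip (fun z z' => far z (+) far z' : nat)) ?path_uniq //.
  rewrite -far_start /walk resolution_pathE.
  elim: (crossed o M) (strand_start o) => [|j l IH] z /=.
    by rewrite far_end /= addbT; case: far.
  have /= h1 := IH (embed o j); have /= h2 := IH (embed o (M j)).
  rewrite [path_pair _ _ _ j]/path_pair; case: (j \in C) => /=;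
    rewrite ?h1 ?h2 doubleD; congr (_ + _);
    by case: far; case: far.
rewrite resolution_pathE /= size_rcons /= negbK size_flatten /shape.
elim: (crossed o M) => //= j l IH.
by rewrite oddD [path_pair _ _ _ j]/path_pair; case: ifP.
Qed.

(** The gap line has one end on each side of the overstrand, and disjoint arcs follow each other in
    the same order at their right and at their left ends. *)
Lemma walk_mono : pairwise mono_step walk.
Proof.
rewrite /walk pairwise_map.
have lt_crossed : pairwise (fun j j' : 'I_(n.*2) => j < j') (crossed o M).
  rewrite crossedE; apply: pairwise_filter.
  rewrite -(pairwise_map (@nat_of_ord _) ltn) val_enum_ord.
  by rewrite -sorted_pairwise ?iota_ltn_sorted //; exact: ltn_trans.
apply: (sub_in_pairwise (P := mem (crossed o M)) _ _ lt_crossed) => [j j'|];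
  last exact/allP.
rewrite !mem_crossed /mono_step /= /far !side_embed // => h h' jj'.
have := partner_nsep M j j'.
have : M j != M j' :> nat.
  rewrite (inj_eq (@ord_inj _)) (inj_eq (inv_inj (partnerK M))).
  by apply: contraTneq jj' => ->; rewrite ltnn.
have := ltn_ord o; have := ltn_ord (M j); have := ltn_ord (M j').
move: h h' jj' ht; rewrite /right_of /side /separates /inside /=.
move: (nat_of_ord j) (nat_of_ord j') (nat_of_ord (M j)) (nat_of_ord (M j')).
by move: (nat_of_ord o) => *; case: (ltnP _ t); lia.
Qed.

(** [P] stands for a pair of opposite quadrants. An arc that misses the overstrand meets the gap
    line exactly when one of its two ends lies in [P]. *)
Lemma uncrossed_le (P : pred 'I_(n.*2)) :
  (forall j, far (embed o j) (+) far (embed o (M j)) = P j (+) P (M j)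
     \/ crosses o M j) ->
  uncrossed_cut + (\sum_(j <- crossed o M) (P j + P (M j))).*2 <=
    (\sum_j P j).*2.
Proof.
move=> hP; rewrite [in leqRHS](bigID (crosses o M)) /= sum_crosses.
rewrite doubleD addnC leq_add2l -addnn.
rewrite [X in _ <= _ + X](reindex_inj (inv_inj (partnerK M))) /=.
have hcr j : crosses o M (M j) = crosses o M j.
  by rewrite /crosses partnerK addbC.
rewrite [X in _ <= _ + X](eq_bigl _ _ (fun j => congr1 negb (hcr j))).
rewrite -big_split /= /uncrossed_cut; apply: leq_sum => j ncr.
by case: (hP j) => [->|cr]; [case: (P j); case: (P (M j))|rewrite cr in ncr].
Qed.

Lemma before_far_le :
  uncrossed_cut + (count_before walk).*2 <= (\sum_j before_far j).*2.
Proof.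
apply: leq_trans (uncrossed_le _).
  rewrite leq_add2l leq_double /count_before !count_map -!sum1_count.
  rewrite ![\sum_(_ <- _ | _) _]big_mkcond -big_split /=.
  rewrite [leqRHS]big_seq [leqLHS]big_seq; apply: leq_sum => j.
  rewrite mem_crossed /before_far => /andP[-> /negbTE ->].
  by case: far; case: far.
move=> j; rewrite /before_far /crosses.
by case: right_of; case: right_of; case: far; case: far; auto.
Qed.

Lemma after_far_le :
  uncrossed_cut + (count_after walk).*2 <= (\sum_j ~~ before_far j).*2.
Proof.
apply: leq_trans (uncrossed_le _).
  rewrite leq_add2l leq_double /count_after !count_map -!sum1_count.
  rewrite ![\sum_(_ <- _ | _) _]big_mkcond -big_split /=.
  rewrite [leqRHS]big_seq [leqLHS]big_seq; apply: leq_sum => j.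
  rewrite mem_crossed /before_far => /andP[-> /negbTE ->].
  by case: far; case: far.
move=> j; rewrite /= /before_far /crosses.
by case: right_of; case: right_of; case: far; case: far; auto.
Qed.

Lemma cut_alternative :
  cut t (resolve o M C) + 2 <= cut (t - (o < t)) M \/
  [/\ cut t (resolve o M C) = cut (t - (o < t)) M + 2,
      (count_A walk).*2 + cut (t - (o < t)) M <=
        (count_B walk).*2 + (\sum_j before_far j).*2 &
      (count_B walk).*2 + cut (t - (o < t)) M <=
        (count_A walk).*2 + (\sum_j ~~ before_far j).*2].
Proof.
have hU := before_far_le; have hV := after_far_le.
rewrite cut_walk cut_resolve.
have [?|[? ? ?]] := path_alternativeP walk_mono; first by left; lia.
by right; split; lia.
Qed.

End Walk.

Section Count.

Variables (n : nat) (o : 'I_n.+1) (t : nat) (M : nsplit n).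
Variable (C : {set 'I_(n.*2)}).
Let D := [set j in crossed o M].

Lemma count_A_walk : C \subset D -> count_A (walk o t M C) = #|C|.
Proof.
move=> CD; rewrite /count_A count_map -size_filter -(card_uniqP _).
  apply: eq_card => j; rewrite mem_filter /=.
  case: (boolP (j \in C)) => // /(subsetP CD); rewrite inE => ->.
  by [].
exact/filter_uniq/crossed_uniq.
Qed.

Lemma count_B_walk : count_B (walk o t M C) = #|D :\: C|.
Proof.
rewrite /count_B count_map -size_filter -(card_uniqP _).
  by apply: eq_card => j; rewrite mem_filter !inE /=.
exact/filter_uniq/crossed_uniq.
Qed.

Lemma size_walk :
  count_A (walk o t M C) + count_B (walk o t M C) = size (crossed o M).
Proof. by rewrite /count_A /count_B count_predC size_map. Qed.

End Count.

Local Open Scope ring_scope.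

(** * The inductive bounds *)

(* [cut] counts arcs twice, whence the factors of the second bound. *)
Definition gap_bounded n (M M' : nsplit n) (y : int) : Prop :=
  y *+ 2 <= (n ^ 2)%N%:Z /\
  forall t, (t <= n)%N -> let z := (cut t M + cut t M')%N in
    (n.*2 <= z)%N -> y *+ 8 <= z%:Z * (n%:Z *+ 4 - z%:Z).

(** With f_n(z) = z(4n - z), decreasing for z >= 2n, the induction rests on f_n(z) + 4z = f_{n+1}(z)
    and f_n(z) + 4(4n - z) = f_{n+1}(z + 4). *)
Lemma gap_arith (n zg zh z : nat) (y d : int) :
  y *+ 2 <= (n ^ 2)%N%:Z ->
  ((n.*2 <= zg)%N -> y *+ 8 <= zg%:Z * (n%:Z *+ 4 - zg%:Z)) ->
  ((n.*2 <= zh)%N -> y *+ 8 <= zh%:Z * (n%:Z *+ 4 - zh%:Z)) ->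
  d *+ 2 <= zg%:Z ->
  (z <= zh)%N \/ z = (zh + 4)%N /\ d *+ 2 + zh%:Z <= n%:Z *+ 4 ->
  (n.+1.*2 <= z)%N -> (y + d) *+ 8 <= z%:Z * (n.+1%:Z *+ 4 - z%:Z).
Proof.
move=> hy hg hh hd hz zn.
have [zgz|zgz] := leqP z zg.
  have {}hg := hg ltac:(lia); nia.
case: hz => [hz|[zE hz]].
  have {}hh := hh ltac:(lia); nia.
(* If [zh] is below 2n here, [z] can only be 2n+2 or 2n+3, next to the maximum of f_{n+1}. *)
have [zhn|zhn] := leqP n.*2 zh.
  have {}hh := hh ltac:(lia); nia.
have [zgn|zgn] := leqP n.*2 zg.
  have {}hg := hg ltac:(lia); nia.
nia.
Qed.

Lemma gap_arith_width (n zg : nat) (y d : int) :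
  y *+ 2 <= (n ^ 2)%N%:Z ->
  ((n.*2 <= zg)%N -> y *+ 8 <= zg%:Z * (n%:Z *+ 4 - zg%:Z)) ->
  d *+ 2 <= zg%:Z -> (y + d) *+ 2 <= (n.+1 ^ 2)%N%:Z.
Proof.
move=> hy hg hd.
have [zgn|zgn] := leqP n.*2 zg; last by nia.
have {}hg := hg ltac:(lia); nia.
Qed.

Lemma gap_bounded_resolve n (o : 'I_n.+1) (M M' : nsplit n)
    (C C' : {set 'I_(n.*2)}) (y : int) :
  let D := [set j in crossed o M] in let D' := [set j in crossed o M'] in
  C \subset D -> C' \subset D' -> gap_bounded M M' y ->
  gap_bounded (resolve o M C) (resolve o M' C')
    (y + ((#|C|%:Z - #|D :\: C|%:Z) - (#|C'|%:Z - #|D' :\: C'|%:Z))).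
Proof.
move=> D D' CD CD' [hy hz].
have hg := hz o (ltn_ord o : (o <= n)%N); rewrite !cut_crossed /= in hg.
(* The numbers of A- and B-splits do not depend on the gap line; 0 is an arbitrary choice. *)
have cA := count_A_walk 0 CD; have cB := count_B_walk o 0 M C.
have cA' := count_A_walk 0 CD'; have cB' := count_B_walk o 0 M' C'.
have s := size_walk o 0 M C; have s' := size_walk o 0 M' C'.
rewrite cA cB -/D in s; rewrite cA' cB' -/D' in s'.
have hd : ((#|C|%:Z - #|D :\: C|%:Z) - (#|C'|%:Z - #|D' :\: C'|%:Z)) *+ 2 <=
    ((size (crossed o M)).*2 + (size (crossed o M')).*2)%N%:Z.
  by rewrite -s -s'; clear; lia.
split=> [|t ht /=]; first exact: gap_arith_width hy hg hd.
have ht' : (t - (o < t) <= n)%N by have := ltn_ord o; case: ltnP; lia.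
have hh := hz _ ht'; rewrite /= in hh.
apply: (gap_arith hy hg hh hd); move: cA cB cA' cB' => _ _ _ _.
move: hy hz hg hh hd s s' => _ _ _ _ _ _ _.
(* The two pairs of quadrants share all 2n points; this bounds the change of power when both cuts
   grow, the only case in which their sum grows. *)
have total : (\sum_j before_far o t j + \sum_j ~~ before_far o t j = n.*2)%N.
  rewrite -big_split /= (eq_bigr (fun _ => 1%N)) ?sum1_card ?card_ord // => j _.
  by case: before_far.
have := cut_alternative o ht M C; have := cut_alternative o ht M' C'.
rewrite !count_A_walk // !count_B_walk -/D -/D'.
by move=> [?|[? ? ?]] [?|[? ? ?]]; solve [left; lia | right; split; lia].
Qed.

(** * Powers and width of the skein relation *)

Lemma mem_msupp_sum (I : finType) (P : pred I) (F : I -> laurent) (t : int) :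
  t \in msupp (\sum_(i | P i) F i) -> exists2 i, P i & t \in msupp (F i).
Proof.
rewrite -mcoeff_neq0 raddf_sum /= => h.
have /existsP[i /andP[Pi hi]] : [exists i, P i && ((F i)@_t != 0)].
  apply: contraNT h; rewrite negb_exists => /forallP h; apply/eqP/big1 => i Pi.
  by apply/eqP; have := h i; rewrite Pi /= negbK.
by exists i => //; rewrite -mcoeff_neq0.
Qed.

Lemma mem_msupp_mul_Apow k (c : laurent) t :
  t \in msupp (mul_Apow k c) -> exists2 s, s \in msupp c & t = k + s.
Proof.
rewrite -mcoeff_neq0 /mul_Apow raddf_sum /= => h.
have /hasP[s sc hs] : has (fun s => t == k + s) (msupp c); last first.
  by exists s => //; apply/eqP.
apply: contraNT h => /hasPn h; rewrite big_seq big1 // => s sc.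
by rewrite mcoeffU eq_sym (negbTE (h s sc)).
Qed.

Lemma cut_le n t (M : nsplit n) : (cut t M <= n.*2)%N.
Proof.
rewrite -[leqRHS]card_ord -sum1_card; apply: leq_sum => j _; exact: leq_b1.
Qed.

Lemma skein_gap_bounded n (x : crossing n.+1) (M M' : nsplit n.+1)
    (t t' : int) :
  t \in msupp (skein x M) -> t' \in msupp (skein x M') ->
  gap_bounded M M' (t - t').
Proof.
elim: n x M M' t t' => [|n IH] x M M' t t'.
  have t0 N s : s \in msupp (strand_relation N) -> s = 0.
    rewrite ffunE; case: eqP => _; last by rewrite msupp0.
    by move/(fsubsetP msuppU_le); rewrite inE => /eqP.
  move=> /t0 -> /t0 ->; split=> // s _ /=.
  by have := cut_le s M; have := cut_le s M'; nia.
pose o := top_strand x; pose R := skein (delete_strand o x).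
have term N s : s \in msupp (skein x N) ->
    exists K : nsplit n.+1, exists2 E : {set 'I_(n.+1.*2)},
    E \subset [set j in crossed o K] &
    resolve o K E = N /\ exists2 r, r \in msupp (R K) &
    s = #|E|%:Z - #|[set j in crossed o K] :\: E|%:Z + r.
  rewrite ffunE => /mem_msupp_sum[K _] /mem_msupp_sum[E /andP[ED /eqP TE]].
  move=> /mem_msupp_mul_Apow[r rR sE].
  by exists K, E; rewrite ?powersetE in ED *; last by split=> //; exists r.
move=> /term[K [E ED [<- [r rR ->]]]] /term[K' [E' ED' [<- [r' rR' ->]]]].
have := gap_bounded_resolve ED ED' (IH _ _ _ _ _ rR rR').
by congr gap_bounded; lia.
Qed.

Lemma width_le n (R : skein_relation n) (b : int) : 0 <= b ->
  (forall M M' t t', t \in msupp (R M) -> t' \in msupp (R M') -> t - t' <= b) ->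
  width R <= b.
Proof.
move=> b0 hb; have mem t : t \in powers R -> exists M, t \in msupp (R M).
  by case/flatten_imageP => M _ tM; exists M.
rewrite /width /highest_power /lowest_power.
have head_in : powers R = [::] \/ head 0 (powers R) \in powers R.
  by case: powers => [|a l]; [left|right; rewrite mem_head].
(* Without terms both extrema are the default 0, and [0 <= b] is used; otherwise the initial value
   is itself a power, so both extrema are attained. *)
case: head_in => [->|hd]; first by rewrite !big_nil subrr.
have [M hM] : exists M,
    \big[Num.max/head 0 (powers R)]_(t <- powers R) t \in msupp (R M).
  apply: mem; rewrite big_seq; apply: (big_ind (fun t => t \in powers R)) => //.
  by move=> s t; rewrite maxEle; case: ifP.
have [M' hM'] : exists M',
    \big[Num.min/head 0 (powers R)]_(t <- powers R) t \in msupp (R M').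
  apply: mem; rewrite big_seq; apply: (big_ind (fun t => t \in powers R)) => //.
  by move=> s t; rewrite minEle; case: ifP.
exact: hb hM hM'.
Qed.

Theorem theorem2p7 (n : nat) (hn : (2 <= n)%N) (R : skein_relation n)
    (hR : is_skein_relation R) :
  (width R <= (n ^ 2 %/ 2)%N%:Z)%R.
Proof.
case: hR => x ->; case: n hn x {R} => // n _ x.
apply: width_le => // M M' t t' tM tM'.
by have [h _] := skein_gap_bounded tM tM'; lia.
Qed.
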